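(* Let $X$ be an infinite-dimensional real Banach space satisfying at least one of the following conditions: (1) $X$ is uniformly Fréchet smooth; (2) there exists $\epsilon>0$ such that the set of all $\epsilon$-cone smooth points of $B_X$ is dense in $S_X$; (3) the Kottman constant of $X$ satisfies $\mathcal K(X)<2$; (4) for each $x\in S_X$, at least one of the following holds: (4a) $x$ is an LUR point; (4b) $x$ is an LND2 point of $B_X$; (4c) $x$ is a Fréchet smooth and strongly exposed point of $B_X$; (4d) $x$ is a Fréchet smooth point of $B_X$ and the unique norm-one functional $f_x\in X^*$ that supports $B_X$ at $x$ determines a slice $\Sigma$ of $B_X$ with $\mathrm{diam}(\Sigma)<2$. Then $X$ does not admit any star-finite covering by closed balls.
   Context: $B_X$ and $S_X$ denote the closed unit ball and unit sphere of $X$. Closed balls have positive radius. A covering of $X$ is a family of nonempty subsets of $X$ whose union is $X$. A family of sets is star-finite if each of its members intersects only finitely many other members. $X$ is uniformly Fréchet smooth if the limit defining the derivative of the norm, $\lim_{t\to0}(\|x+th\|-\|x\|)/t$, exists uniformly for $(x,h)\in S_X\times S_X$. For $f\in S_{X^*}$ and $\alpha\in[0,1)$ put $\mathrm C(\alpha,f)=\{x\in X: f(x)\ge\alpha\|x\|\}$. For $\epsilon>0$, a point $x\in S_X$ is an $\epsilon$-cone smooth point of $B_X$ if there is $f_x\in S_{X^*}$ such that $[x-\mathrm C(\tfrac17,f_x)]\cap[x+\epsilon B_X]\subset B_X$. $\mathcal K(X)=\sup\{\mathrm{sep}\,A: A\subset S_X,\ |A|=\aleph_0\}$, where $\mathrm{sep}\,A=\inf\{\|a-b\|: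 a,b\in A,\ a\ne b\}$. A point $x\in S_X$ is: an LUR point if $x_n\in S_X$, $\|x+x_n\|\to2$ imply $x_n\to x$ in norm; an LND2 point of $B_X$ if there exists $\delta>0$ such that $\mathrm{diam}\{y\in S_X: \|\frac{x+y}2\|\ge1-\delta\}<2$; a Fréchet smooth point if the norm is Fréchet differentiable at $x$; a strongly exposed point of $B_X$ if there is $f\in S_{X^*}$ with $f(x)=1$ such that $x_n\in B_X$, $f(x_n)\to1$ imply $x_n\to x$ in norm. A slice of $B_X$ determined by $f\in S_{X^*}$ is a set of the form $\{y\in B_X: f(y)>1-\delta\}$ with $\delta>0$. *)

(* Defs.v *)
From HB Require Import structures.
From mathcomp Require Import all_boot all_order all_algebra.
From mathcomp Require Import all_classical all_reals all_analysis.

Set Implicit Arguments.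
Unset Strict Implicit.
Unset Printing Implicit Defensive.
Import Order.TTheory GRing.Theory Num.Theory.
Import numFieldNormedType.Exports.

Local Open Scope classical_set_scope.
Local Open Scope ring_scope.
Local Open Scope card_scope.

Section BallCoverings.
Context {R : realType} {X : completeNormedModType R}.

Definition unit_ball : set X := closed_ball 0 1.
Definition unit_sphere : set X := [set x | `|x| = 1].

(* Infima and suprema are taken in \bar R, so that they need no side
   conditions: sep = +oo on sets with at most one element, and the diameter
   of the empty set is -oo (it is only used below for nonempty sets). *)
Definition diam (A : set X) : \bar R :=
  ereal_sup [set `|p.1 - p.2|%:E | p in A `*` A].

Definition sep (A : set X) : \bar R :=
  ereal_inf [set `|p.1 - p.2|%:E | p in [set p | A p.1 /\ A p.2 /\ p.1 <> p.2]].

Definition dual_norm (f : {linear X -> R^o}) : \bar R :=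
  ereal_sup [set `|f x|%:E | x in unit_ball].

Definition dual_sphere : set {linear X -> R^o} :=
  [set f : {linear X -> R^o} | continuous f /\ dual_norm f = 1%:E].

Definition supports (f : {linear X -> R^o}) (C : set X) (x : X) : Prop :=
  C x /\ forall y, C y -> f y <= f x.

Definition slice (f : {linear X -> R^o}) (delta : R) : set X :=
  [set y | unit_ball y /\ f y > 1 - delta].

Definition cone (alpha : R) (f : {linear X -> R^o}) : set X :=
  [set x | f x >= alpha * `|x|].

Definition cone_smooth_point (eps : R) (x : X) : Prop :=
  unit_sphere x /\
  exists2 f : {linear X -> R^o}, dual_sphere f &
    [set x - c | c in cone 7^-1 f] `&` [set x + eps *: b | b in unit_ball]
      `<=` unit_ball.

Definition lur_point (x : X) : Prop :=
  unit_sphere x /\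
  forall u : nat -> X, (forall n, unit_sphere (u n)) ->
    `|x + u n| @[n --> \oo] --> (2 : R) -> u n @[n --> \oo] --> x.

Definition lnd2_point (x : X) : Prop :=
  unit_sphere x /\
  exists2 delta : R, 0 < delta &
    (diam [set y | unit_sphere y /\ `|2^-1 *: (x + y)| >= 1 - delta]%R
      < 2%:E)%E.

Definition frechet_smooth_point (x : X) : Prop :=
  unit_sphere x /\ differentiable (fun y : X => `|y| : R^o) x.

Definition strongly_exposed_point (x : X) : Prop :=
  unit_sphere x /\
  exists2 f : {linear X -> R^o}, dual_sphere f & f x = 1 /\
    forall u : nat -> X, (forall n, unit_ball (u n)) ->
      f (u n) @[n --> \oo] --> (1 : R^o) -> u n @[n --> \oo] --> x.

(* For a Frechet smooth point x the functional below exists and is unique. *)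
Definition support_slice_diam_lt2 (x : X) : Prop :=
  exists f : {linear X -> R^o},
    [/\ dual_sphere f, supports f unit_ball x,
        forall g, dual_sphere g -> supports g unit_ball x -> g =1 f &
        exists2 delta : R, 0 < delta & (diam (slice f delta) < 2%:E)%E].

End BallCoverings.

Section Spaces.
Context {R : realType}.
Variable X : completeNormedModType R.

Definition infinite_dimensional : Prop :=
  ~ exists n (e : 'I_n -> X),
      forall x, exists c : 'I_n -> R, x = \sum_(i < n) c i *: e i.

Definition uniformly_frechet_smooth : Prop :=
  exists d : X * X -> R,
    {uniform unit_sphere `*` unit_sphere,
      (fun (t : R) (p : X * X) => (`|p.1 + t *: p.2| - `|p.1|) / t) @ 0^'
        --> d}.

Definition kottman : \bar R :=
  ereal_sup [set sep A | A in
    [set A : set X | A `<=` unit_sphere /\ A #= [set: nat]]].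

Definition covering (F : set (set X)) : Prop :=
  (forall A, F A -> A !=set0) /\ \bigcup_(A in F) A = [set: X].

Definition star_finite (F : set (set X)) : Prop :=
  forall A, F A -> finite_set [set B | F B /\ B <> A /\ A `&` B !=set0].

Definition by_closed_balls (F : set (set X)) : Prop :=
  forall A, F A -> exists c (r : R), 0 < r /\ A = closed_ball c r.

End Spaces.

(* Main.v *)
Require Import Defs.
From HB Require Import structures.
From mathcomp Require Import all_boot all_order all_algebra.
From mathcomp Require Import all_classical all_reals all_analysis.
From mathcomp Require Import ring lra.

Set Implicit Arguments.
Unset Strict Implicit.
Unset Printing Implicit Defensive.
Import Order.TTheory GRing.Theory Num.Theory.
Import numFieldNormedType.Exports.

Local Open Scope classical_set_scope.
Local Open Scope ring_scope.

(** A star-finite covering by balls may be replaced by an irredundant one. In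
    infinite dimension every ball of an irredundant covering then carries a
    point at which members of the covering accumulate: a point belonging to this
    ball alone can be moved, along a direction killed by the functionals that
    separate it from the finitely many neighbouring balls, until it leaves the
    ball without ever entering a neighbour ([accumulation_point_on_ball]).

    If, for each [d > 0], the balls of radius at least [d] were locally finite,
    then near every accumulation point there would be a tiny ball away from all
    balls of radius at least [d], hence another accumulation point with a
    neighbourhood avoiding them. Letting [d] tend to zero, nested balls would
    produce a point that is not covered. So there are [d > 0] and [x] such that
    infinitely many balls of radius at least [d] come arbitrarily near [x], and
    star-finiteness lets them be chosen pairwise disjoint and disjoint from a
    ball having [x] on its frontier ([disjoint_balls_cluster]). All this holds
    in every infinite-dimensional Banach space; the geometric conditions exclude
    the resulting configuration.

    From [x], the centres of these balls are seen in directions [u n] at mutual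
    distance almost two, so the Kottman constant is two; moreover [`|v + u n|] is
    almost two, where [v] is the direction to [x] from the centre of the ball
    that carries [x], so [v] is not an LND2 point
    ([star_finite_covering_directions]). The other pointwise conditions imply
    LND2: an LUR point satisfies it directly, and at a Frechet smooth point
    supported by [f] the unit vectors [u] for which [`|v + u|] is almost two
    lie in thin slices of [f] ([frechet_smooth_slice]).

    If cone smooth points are dense, each of the accumulating balls contains a
    cone of fixed size with vertex near [x]. Among any four cones two have a
    common interior direction ([functionals_common_direction]), so two of the
    balls meet. Uniform Frechet smoothness makes every point of the sphere cone
    smooth with the same [e]. *)

(** * Hahn-Banach *)

(** Homogeneity is only demanded as an inequality and for positive scalars:
    applied to the inverse scalar it gives equality, and [p 0 = 0] follows. *)
Definition sublinear (R : realType) (V : lmodType R) (p : V -> R) : Prop :=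
  (forall x y, p (x + y) <= p x + p y) /\
  (forall t x, 0 < t -> p (t *: x) <= t * p x).

Section HahnBanach.
Context {R : realType} {V : lmodType R}.
Implicit Types p : V -> R.

Lemma sublinearZ p t x : sublinear p -> 0 < t -> p (t *: x) = t * p x.
Proof.
move=> [_ pZ] t0; apply/eqP; rewrite eq_le pZ//= mulrC -ler_pdivlMr// mulrC.
have ti0 : 0 < t^-1 by rewrite invr_gt0.
by have := pZ _ (t *: x) ti0; rewrite scalerA mulVf ?gt_eqF// scale1r.
Qed.

Lemma sublinear0 p : sublinear p -> p 0 = 0.
Proof.
move=> pS; have := sublinearZ 0 pS (ltr0Sn R 1); rewrite scaler0; lra.
Qed.

Lemma sublinear_geN p x : sublinear p -> - p (- x) <= p x.
Proof.
move=> pS; have := pS.1 x (- x); rewrite subrr sublinear0//; lra.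
Qed.

(** The largest sublinear functional below [p] that is at most [- p y] at
    [- y]; comparing it with [p] is what makes a minimal [p] odd. *)
Definition descend p (y x : V) : R :=
  inf [set p (x + t *: y) - t * p y | t in [set t | 0 <= t]].

Lemma descend_le p y x t : sublinear p -> 0 <= t ->
  descend p y x <= p (x + t *: y) - t * p y.
Proof.
move=> pS t0; apply: ge_inf; last by exists t.
exists (- p (- x)) => _ [s /= s0 <-].
have : p (s *: y) = s * p y.
  move: s0; rewrite le_eqVlt => /predU1P[<-|s0]; last exact: sublinearZ.
  by rewrite scale0r mul0r sublinear0.
have := pS.1 (x + s *: y) (- x).
rewrite addrAC subrr add0r; lra.
Qed.

Lemma descend_ge p y x a : sublinear p ->
  (forall t, 0 <= t -> a <= p (x + t *: y) - t * p y) -> a <= descend p y x.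
Proof.
move=> pS h; apply: lb_le_inf; last by move=> _ [t /= t0 <-]; exact: h.
by exists (p (x + 0 *: y) - 0 * p y), 0 => //=.
Qed.

Lemma sublinear_descend p y : sublinear p -> sublinear (descend p y).
Proof.
move=> pS; split=> [x x'|t x t0].
  rewrite -lerBlDl; apply: descend_ge => // t' t'0.
  rewrite lerBlDr -lerBlDl; apply: descend_ge => // t t_ge0.
  have tt' : 0 <= t + t' by rewrite addr_ge0.
  have := descend_le y (x + x') pS tt'.
  have := pS.1 (x + t *: y) (x' + t' *: y).
  rewrite addrACA -scalerDl; lra.
rewrite mulrC -ler_pdivrMr//; apply: descend_ge => // s s0.
rewrite ler_pdivrMr//.
have ts0 : 0 <= t * s by rewrite mulr_ge0// ltW.
have := descend_le y (t *: x) pS ts0.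
rewrite -scalerA -scalerDr (sublinearZ _ pS t0); lra.
Qed.

(** Zorn's lemma gives a minimal sublinear [q] below [p] (along a chain the
    pointwise infimum is again sublinear). By minimality [descend q y = q],
    hence [q (- y) = - q y] for all [y], and an odd sublinear functional is
    linear. *)
Lemma hahn_banach_sublinear p : sublinear p ->
  exists f : {linear V -> R^o}, forall x, f x <= p x.
Proof.
move=> pS.
pose T := {q : V -> R | sublinear q /\ forall x, q x <= p x}.
pose rT : rel T := fun q q' => `[< forall x, sval q' x <= sval q x >].
have [|||q qmin] := @ZL_preorder T (exist _ p (conj pS (fun x => lexx (p x)))) rT.
- by move=> q; apply/asboolP.
- move=> q1 q2 q3 /asboolP h12 /asboolP h23; apply/asboolP => x.
  exact: le_trans (h23 x) (h12 x).
- move=> C Ctot; have [C0|/set0P[q0 Cq0]] := eqVneq C set0.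
    exists (exist _ p (conj pS (fun x => lexx (p x)))) => s.
    by rewrite C0.
  pose m x := inf [set sval q x | q in C].
  have m_le q x : C q -> m x <= sval q x.
    move=> Cq; apply: ge_inf; last by exists q.
    exists (- p (- x)) => _ [r _ <-].
    have [rS rp] := svalP r.
    apply: le_trans (sublinear_geN x rS); rewrite lerN2; exact: rp.
  have m_ge x a : (forall q, C q -> a <= sval q x) -> a <= m x.
    move=> h; apply: lb_le_inf; last by move=> _ [r /= Cr <-]; exact: h.
    by exists (sval q0 x), q0.
  have mS : sublinear m.
    split=> [x x'|t x t0].
      rewrite -lerBlDl; apply: (m_ge _ _) => q' Cq'.
      rewrite lerBlDr -lerBlDl; apply: (m_ge _ _) => q Cq.
      have [/asboolP qq'|/asboolP qq'] := Ctot _ _ Cq Cq'.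
        have := m_le _ (x + x') Cq'; have := (svalP q').1.1 x x'.
        have := qq' x; lra.
      have := m_le _ (x + x') Cq; have := (svalP q).1.1 x x'.
      have := qq' x'; lra.
    rewrite mulrC -ler_pdivrMr//; apply: (m_ge _ _) => q Cq; rewrite ler_pdivrMr//.
    by rewrite mulrC -(sublinearZ _ (svalP q).1)//; exact: m_le.
  have mp x : m x <= p x by apply: le_trans (m_le _ _ Cq0) ((svalP q0).2 x).
  by exists (exist _ m (conj mS mp)) => q Cq; apply/asboolP => x; exact: m_le.
case: q qmin => q [qS qp] qmin.
have qN y : q (- y) = - q y.
  apply/eqP; rewrite eq_le; apply/andP; split; last first.
    by have := sublinear_geN (- y) qS; rewrite opprK.
  have dS := sublinear_descend y qS.
  have dq x : descend q y x <= q x.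
    by have := descend_le y x qS (lexx 0); rewrite scale0r mul0r addr0 subr0.
  have dp x : descend q y x <= p x := le_trans (dq x) (qp x).
  have /asboolP/= /(_ (- y)) h : rT (exist _ (descend q y) (conj dS dp))
      (exist _ q (conj qS qp)) by apply: qmin; apply/asboolP.
  apply: (le_trans h); have := descend_le y (- y) qS ler01.
  by rewrite scale1r addNr sublinear0// mul1r sub0r.
have qD x y : q (x + y) = q x + q y.
  apply/eqP; rewrite eq_le qS.1/=.
  have := qS.1 (- x) (- y); rewrite -opprD !qN; lra.
have q_lin : linear_for *:%R (q : V -> R^o).
  move=> a x y; rewrite qD; congr (_ + _); change (q (a *: x) = a * q x).
  have [a0|a0|->] := ltgtP a 0; last by rewrite mul0r scale0r sublinear0.
    rewrite -[a]opprK scaleNr qN sublinearZ ?oppr_gt0//; ring.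
  exact: sublinearZ.
pose L := GRing.isLinear.Build R V R^o *:%R (q : V -> R^o) q_lin.
pose f : {linear V -> R^o} := HB.pack (q : V -> R^o) L.
by exists f => x; exact: qp.
Qed.

End HahnBanach.

(** Dominating by the descent of the norm along [z], rather than by the norm
    itself, forces [f (- z) <= - `|z|]. *)
Lemma norm_attaining_functional (R : realType) (X : normedModType R) (z : X) :
  exists f : {linear X -> R^o}, (forall x, `|f x| <= `|x|) /\ f z = `|z|.
Proof.
have normS : sublinear (fun x : X => `|x|).
  by split=> [x y|t x t0]; rewrite ?ler_normD// normrZ gtr0_norm.
have [f fd] := hahn_banach_sublinear (sublinear_descend z normS).
have fn x : f x <= `|x|.
  apply: le_trans (fd x) _.
  by have := descend_le z x normS (lexx 0); rewrite scale0r mul0r addr0 subr0.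
exists f; split=> [x|].
  by rewrite ler_norml fn andbT lerNl -linearN -normrN fn.
apply/eqP; rewrite eq_le fn/= -lerN2 -linearN; apply: le_trans (fd _) _.
have := descend_le z (- z) normS ler01.
by rewrite scale1r addNr normr0 mul1r sub0r.
Qed.

(** * Finitely many functionals and closed balls *)

Lemma functionalZ (R : realType) (V : lmodType R) (f : {linear V -> R^o}) a v :
  f (a *: v) = a * f v.
Proof. by rewrite linearZ. Qed.

(** Finitely many functionals cannot be jointly injective in infinite
    dimension. The induction on the list proves more: modulo the common kernel
    the space is spanned by a finite family, so that a trivial common kernel
    would make [X] finite-dimensional. *)
Lemma common_kernel_vector (R : realType) (X : completeNormedModType R)
    (T : eqType) (F : T -> {linear X -> R^o}) (s : seq T) :
  infinite_dimensional X -> exists2 v, v != 0 & forall i, i \in s -> F i v = 0.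
Proof.
move=> infX.
have [n [e he]] : exists n (e : 'I_n -> X), forall x, exists c : 'I_n -> R,
    forall i, i \in s -> F i (x - \sum_(k < n) c k *: e k) = 0.
  elim: s => [|i s [n [e IH]]].
    by exists 0%N, (fun _ => 0) => x; exists (fun _ => 0).
  have [[w ws wi]|now] :=
      pselect (exists2 w, (forall j, j \in s -> F j w = 0) & F i w != 0).
    (* [w] is prepended to the family and takes care of the new functional *)
    pose ext T' (a : T') (b : 'I_n -> T') (k : 'I_n.+1) :=
      if unlift ord0 k is Some k' then b k' else a.
    exists n.+1, (ext _ w e) => x; have [c hc] := IH x.
    pose y := x - \sum_(k < n) c k *: e k.
    exists (ext _ (F i y / F i w) c) => j.
    rewrite big_ord_recl /ext unlift_none.
    under eq_bigr do rewrite liftK.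
    rewrite opprD addrCA -/y addrC linearB functionalZ inE => /predU1P[->|js].
      apply/eqP; rewrite subr_eq0; apply/eqP;
      by rewrite divfK.
    have wj : F j w = 0 :> R := ws j js.
    by rewrite wj mulr0 subr0 hc.
  exists n, e => x; have [c hc] := IH x; exists c => j.
  rewrite inE => /predU1P[->|]; last exact: hc.
  by apply: contra_notP now => /eqP h; exists (x - \sum_(k < n) c k *: e k).
apply: contra_notP infX => nov; exists n, e => x.
have [c hc] := he x; exists c; apply/eqP; rewrite -subr_eq0.
by apply: contra_notT nov => ?; exists (x - \sum_(k < n) c k *: e k).
Qed.

Section BallGeometry.
Context {R : realType} {X : normedModType R}.
Implicit Types (x c : X) (r s : R).

Lemma in_closed_ball c r x : 0 < r -> closed_ball c r x <-> `|x - c| <= r.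
Proof. by move=> r0; rewrite closed_ballE// /closed_ball_/= distrC. Qed.

Lemma in_ball c r x : ball c r x <-> `|x - c| < r.
Proof. by rewrite -ball_normE/= distrC. Qed.

(** If the inequality failed, the point dividing the segment of centres in the
    ratio of the radii would lie in both balls. *)
Lemma disjoint_closed_balls c r c' r' : 0 < r -> 0 < r' ->
  closed_ball c r `&` closed_ball c' r' = set0 -> r + r' < `|c - c'|.
Proof.
move=> r0 r'0 dis; rewrite ltNge; apply/negP => le_rr'.
have rr0 : 0 < r + r' by rewrite addr_gt0.
have : (closed_ball c r `&` closed_ball c' r') (c + (r / (r + r')) *: (c' - c)).
  split; apply/in_closed_ball => //.
    rewrite addrAC subrr add0r normrZ gtr0_norm ?divr_gt0// distrC.
    by rewrite mulrAC ler_pdivrMr// ler_pM2l.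
  rewrite -(opprB c c') scalerN addrAC -{1}[c - c']scale1r -scalerBl.
  have -> : 1 - r / (r + r') = r' / (r + r') by field; rewrite gt_eqF.
  rewrite normrZ gtr0_norm ?divr_gt0//.
  by rewrite mulrAC ler_pdivrMr// ler_pM2l.
by rewrite dis.
Qed.

Lemma closed_ball_exit c r y v : 0 < r -> `|y - c| <= r -> v != 0 ->
  exists t, `|y + t *: v - c| = r.
Proof.
move=> r0 yr v0; have nv0 : 0 < `|v| by rewrite normr_gt0.
pose g t := `|y + t *: v - c|.
have gc : continuous g.
  move=> t; apply: cvg_norm; apply: cvgB; last exact: cvg_cst.
  apply: cvgD; first exact: cvg_cst.
  exact: scalel_continuous.
pose T := (r + r) / `|v|.
have T0 : 0 <= T by rewrite divr_ge0// ?ltW// addr_gt0.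
have gT : r <= g T.
  have : `|T *: v| <= g T + `|y - c|.
    rewrite /g -[X in `|X| <= _](addrK (y - c)) (le_trans (ler_normB _ _))//.
    by rewrite addrCA addrA.
  rewrite normrZ ger0_norm// divfK ?gt_eqF//; lra.
have g0 : g 0 <= r by rewrite /g scale0r addr0.
have [||t _ gt] := @IVT R g 0 T r T0; last by exists t.
  exact: continuous_subspaceT.
by rewrite ge_min g0 le_max gT orbT.
Qed.

Lemma closed_ball_frontier_exit c r x s : 0 < r -> `|x - c| = r -> 0 < s ->
  exists2 y, ball x s y & ~ closed_ball c r y.
Proof.
move=> r0 xr s0; pose t := s / (r + r); have t0 : 0 < t by rewrite divr_gt0 ?addr_gt0.
exists (x + t *: (x - c)).
  apply/in_ball; rewrite addrAC subrr add0r normrZ xr gtr0_norm// /t.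
  have -> : s / (r + r) * r = s / 2 by field; rewrite ?gt_eqF ?addr_gt0.
  lra.
move/(in_closed_ball _ _ r0); rewrite addrAC -{1}[x - c]scale1r -scalerDl normrZ xr.
rewrite gtr0_norm; last lra.
by rewrite mulrDl mul1r gerDl leNgt mulr_gt0.
Qed.

End BallGeometry.

(** * Irredundant star-finite coverings *)

Definition irredundant (T : Type) (F : set (set T)) : Prop :=
  forall B, F B -> exists2 y, B y & forall B', F B' -> B' y -> B' = B.

Definition meeting (T : Type) (F : set (set T)) (A : set T) : set (set T) :=
  [set B | F B /\ B `&` A !=set0].

Section Coverings.
Context {R : realType} {X : completeNormedModType R}.
Implicit Types (F G : set (set X)) (A B : set X) (x y : X).

Definition clusters F x : Prop :=
  forall s : R, 0 < s -> infinite_set (meeting F (ball x s)).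

Definition large F (delta : R) : set (set X) :=
  [set B | F B /\ exists c (r : R), delta <= r /\ B = closed_ball c r].

Lemma finite_subset_of_chain (T : eqType) (C : set (set T)) (A : set T) :
  total_on C subset -> C !=set0 -> finite_set A -> A `<=` \bigcup_(H in C) H ->
  exists2 H, C H & A `<=` H.
Proof.
move=> Ctot [H0 CH0] /finite_seqP[s ->].
elim: s => [|a s IH] sC; first by exists H0.
have [H CH sH] : exists2 H, C H & [set` s] `<=` H.
  by apply: IH => b bs; apply: sC; rewrite /= inE orbC (_ : b \in s).
have [K CK Ka] : (\bigcup_(H in C) H) a by apply: sC; rewrite /= mem_head.
have [HK|KH] := Ctot _ _ CH CK.
  by exists K => // b; rewrite /= inE => /predU1P[->//|/sH/HK].
by exists H => // b; rewrite /= inE => /predU1P[->|/sH//]; exact: KH.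
Qed.

(** Zorn's lemma applies to the families [H] whose removal leaves a covering.
    Point-finiteness makes them closed under unions of chains: if the union of
    a chain contained the finitely many members through some point, so would
    one element of the chain. *)
Lemma irredundant_subcovering F :
  covering F -> (forall x, finite_set [set B | F B /\ B x]) ->
  exists2 G, G `<=` F & covering G /\ irredundant G.
Proof.
move=> [Fne Fcov] Ffin.
pose P H := forall x, exists2 B, F B /\ ~ H B & B x.
have [|H [PH Hmax]] := @Zorn_bigcup (set X) P.
  move=> C CP Ctot x; apply/not_exists2P => noB.
  have FxC : [set B | F B /\ B x] `<=` \bigcup_(H in C) H.
    by move=> B [FB Bx]; apply: contrapT => nB; have [[]|] := noB B.
  have [B0 FB0 B0x] : (\bigcup_(A in F) A) x by rewrite Fcov.
  have [H0 CH0 _] := FxC B0 (conj FB0 B0x).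
  have [|H CH FxH] := finite_subset_of_chain Ctot _ (Ffin x) FxC.
    by exists H0.
  by have [B [FB nHB] Bx] := CP _ CH x; apply/nHB/FxH.
exists (F `\` H); first by move=> B [].
split; first split.
- by move=> B [/Fne].
- by rewrite -subTset => x _; have [B FB Bx] := PH x; exists B.
move=> B [FB nHB].
have : ~ P (H `|` [set B]).
  by apply: Hmax; split; [move=> A; left | move=> /(_ B) h; apply/nHB/h; right].
move=> /existsNP[y noB].
have only B' : (F `\` H) B' -> B' y -> B' = B.
  move=> [FB' nHB'] B'y; apply: contrapT => B'B; apply: noB.
  by exists B' => //; split=> // -[].
exists y => //; have [B' FHB' B'y] := PH y.
by rewrite -(only B').
Qed.

Lemma not_clusters F x : ~ clusters F x ->
  exists2 s : R, 0 < s & finite_set (meeting F (ball x s)).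
Proof.
by move=> /existsNP[s] /not_implyP[s0] /contrapT fin; exists s.
Qed.

Lemma avoid_finite_closed F x : finite_set F -> (forall B, F B -> closed B) ->
  (forall B, F B -> ~ B x) ->
  exists2 s : R, 0 < s & forall B y, F B -> ball x s y -> ~ B y.
Proof.
move=> finF clF nFx; have := closed_bigcup finF clF.
rewrite -openC => oF.
have nF : (~` \bigcup_(B in F) B) x by move=> [B FB]; exact: nFx.
have /nbhs_ballP[s /= s0 sF] := open_nbhs_nbhs (conj oF nF).
by exists s => // B y FB /sF; apply: contra_not => By; exists B.
Qed.

Lemma star_finite_sub F G : G `<=` F -> star_finite F -> star_finite G.
Proof.
move=> GF sfF A /GF/sfF; apply: sub_finite_set => B [GB hB].
by split=> //; exact: GF.
Qed.

Lemma star_finite_meeting F A : star_finite F -> F A ->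
  finite_set (meeting F A).
Proof.
move=> sfF FA; apply: (@sub_finite_set _ _
  (A |` [set B | F B /\ B <> A /\ A `&` B !=set0])).
  move=> B [FB BA]; have [->|nBA] := pselect (B = A); [by left|right].
  by split=> //; split=> //; rewrite setIC.
by rewrite finite_setU; split; [exact: finite_set1 | exact: sfF].
Qed.

Lemma star_finite_point_finite F x : star_finite F ->
  finite_set [set B | F B /\ B x].
Proof.
move=> sfF; have [[A [FA Ax]]|no] := pselect (exists A, F A /\ A x).
  apply: sub_finite_set (star_finite_meeting sfF FA) => B [FB Bx].
  by split=> //; exists x.
by apply: (@sub_finite_set _ _ set0) => // B ?; apply: no; exists B.
Qed.

(** Infinite dimension enters here. Some [y] in [B] lies in no other member.
    Separate [y] from each of the finitely many neighbours of [B] by a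
    functional and move from [y] inside the common kernel: the line avoids all
    these neighbours, so the point where it leaves [B] lies in [B] only. Were
    only finitely many members near that point, the members other than [B] would
    all miss a neighbourhood of it, part of which lies outside [B]. *)
Lemma accumulation_point_on_ball F B : infinite_dimensional X ->
  by_closed_balls F -> covering F -> irredundant F -> star_finite F -> F B ->
  exists2 x, B x & clusters F x.
Proof.
move=> infX ballF [_ Fcov] irrF sfF FB.
have [y By yB] := irrF B FB; have [c [r [r0 Bcr]]] := ballF B FB.
have /finite_seqP[N NE] := sfF B FB.
have [f fP] : exists f : set X -> {linear X -> R^o}, forall B', B' \in N ->
    forall z, f B' (z - y) = 0 -> ~ B' z.
  suff /choice[f fP] : forall B', exists f : {linear X -> R^o}, B' \in N ->
      forall z, f (z - y) = 0 -> ~ B' z by exists f.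
  move=> B'; have [B'N|] := boolP (B' \in N); last by exists \0%R.
  have [FB' [B'B _]] : [set B' | F B' /\ B' <> B /\ B `&` B' !=set0] B'.
    by rewrite NE.
  have [c' [r' [r'0 B'E]]] := ballF B' FB'.
  have [f [fle fy]] := norm_attaining_functional (y - c').
  exists f => _ z fz; rewrite B'E => /(in_closed_ball _ _ r'0) zc'.
  apply/B'B/yB => //; rewrite B'E; apply/in_closed_ball => //.
  apply: le_trans zc'; rewrite -fy (le_trans (ler_norm _))//.
  have -> : f (y - c') = f (z - c').
    have -> : f (z - c') = f (z - y) + f (y - c') by rewrite -linearD subrKA.
    by rewrite fz add0r.
  exact: fle.
have [v v0 fv] := common_kernel_vector f N infX.
have yc : `|y - c| <= r by apply/in_closed_ball => //; rewrite -Bcr.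
have [t] := closed_ball_exit r0 yc v0; set x := y + t *: v => xr.
have Bx : B x by rewrite Bcr; apply/in_closed_ball => //; rewrite xr.
have onlyB B' : F B' -> B' x -> B' = B.
  move=> FB' B'x; apply: contrapT => B'B.
  have B'N : B' \in N.
    have : [set B' | F B' /\ B' <> B /\ B `&` B' !=set0] B'.
      by split=> //; split=> //; exists x.
    by rewrite NE.
  apply: (fP _ B'N x) B'x; rewrite /x addrAC subrr add0r linearZ/=.
  by rewrite fv// scaler0.
exists x => // s s0 fin.
have [||s' s'0 s'B] := @avoid_finite_closed
    (meeting F (ball x s) `\ B) x (finite_setD _ fin).
- move=> B' [[/ballF[c' [r' [r'0 ->]]] _] _].
  exact: closed_ball_closed.
- by move=> B' [[FB' _] B'B] /(onlyB _ FB').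
have m0 : 0 < Num.min s s' by rewrite lt_min s0.
have [z zs nBz] := closed_ball_frontier_exit r0 xr m0.
have [zs1 zs2] : ball x s z /\ ball x s' z.
  by move: zs => /in_ball; rewrite lt_min => /andP[? ?]; split; apply/in_ball.
have [B' FB' B'z] : (\bigcup_(A in F) A) z by rewrite Fcov.
apply: (s'B B' z _ _ B'z) => //; split; first by split=> //; exists z.
by move=> B'B; apply: nBz; rewrite -Bcr -B'B.
Qed.
End Coverings.

(** * Accumulation of balls whose radii are bounded below *)

Section Accumulation.
Context {R : realType} {X : completeNormedModType R}.
Implicit Types (F G : set (set X)) (A B : set X) (x y : X).

Lemma exists_small_inv (r : R) : 0 < r -> exists n, n.+1%:R^-1 < r.
Proof.
move=> r0; exists (Num.truncn r^-1).
by rewrite -ltf_pV2 ?posrE ?invr_gt0// invrK truncnS_gt.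
Qed.

Lemma nested_balls_point (a : nat -> X) (s : nat -> R) :
  (forall n, 0 < s n <= n.+1%:R^-1) ->
  (forall n y, `|y - a n.+1| <= s n.+1 -> `|y - a n| <= s n) ->
  exists l, forall n, `|l - a n| <= s n.
Proof.
move=> sn nest.
have s0 n : 0 < s n by have /andP[] := sn n.
have sub n m : (n <= m)%N -> forall y, `|y - a m| <= s m -> `|y - a n| <= s n.
  elim: m => [|m IH]; first by rewrite leqn0 => /eqP ->.
  rewrite leq_eqVlt => /predU1P[->//|/IH h y /nest]; exact: h.
have ain n m : (n <= m)%N -> `|a m - a n| <= s n.
  by move=> nm; apply: (sub _ _ nm); rewrite subrr normr0 ltW.
have : cvg (a @ \oo).
  apply: cauchy_cvg; apply: cauchy_exP => e e0.
  have [n ne] := exists_small_inv e0.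
  exists (a n), n => // m nm; apply/in_ball.
  apply: (le_lt_trans (ain _ _ nm)); apply: le_lt_trans ne.
  by have /andP[] := sn n.
rewrite cvg_ex => -[l al]; exists l => n.
apply/in_closed_ball => //.
apply: (@closed_cvg _ _ \oo eventually_filter a) al.
  exact: closed_ball_closed.
by exists n => // m nm; apply/in_closed_ball => //; exact: ain.
Qed.

(** By local finiteness only finitely many members of radius at least [d] come
    near [x]. But infinitely many members do, so one of them is tiny,
    close to [x], and disjoint from these large ones; it carries an accumulation
    point [x'], and a small ball about [x'] avoids all members of radius at least
    [d]. *)
Lemma nested_step F (d s : R) x : infinite_dimensional X ->
  by_closed_balls F -> covering F -> irredundant F -> star_finite F ->
  (forall (e : R) y, 0 < e -> ~ clusters (large F e) y) ->
  clusters F x -> 0 < s -> 0 < d ->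
  exists x' (s' : R), [/\ clusters F x', 0 < s' <= d &
    forall y, `|y - x'| <= s' -> `|y - x| <= s /\
      forall B, large F d B -> ~ B y].
Proof.
move=> infX ballF covF irrF sfF locfin accx s0 d0.
have [t1 t10 fint1] := not_clusters (locfin d x d0).
pose t := Num.min t1 s; have t0 : 0 < t by rewrite lt_min t10.
(* the large members that can matter near [x] *)
pose E := meeting (large F d) (ball x t).
have finE : finite_set E.
  apply: sub_finite_set fint1 => B [LB [z [Bz xz]]]; split=> //; exists z.
  by split=> //; apply: le_ball xz; rewrite ge_min lexx.
have t80 : 0 < t / 8 by rewrite divr_gt0.
have [u1 u10 finu1] := not_clusters (locfin (t / 8) x t80).
pose u := Num.min u1 (t / 8); have u0 : 0 < u by rewrite lt_min u10.
(* the members to be avoided: those touching [E], and those that are not tiny *)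
pose E' := (\bigcup_(A in E) meeting F A) `|` meeting (large F (t / 8)) (ball x u1).
have finE' : finite_set E'.
  rewrite finite_setU; split=> //; apply: bigcup_finite => // A [[FA _] _].
  exact: star_finite_meeting.
have [B [[FB [z [Bz xz]]] nE'B]] := infinite_setN0 (infinite_setD (accx u u0) finE').
have [c [r [r0 Bcr]]] := ballF B FB.
have rt : r < t / 8.
  rewrite ltNge; apply/negP => tr; apply: nE'B; right; split.
    by split=> //; exists c, r.
  by exists z; split=> //; apply: le_ball xz; rewrite ge_min lexx.
have [x' Bx' accx'] := accumulation_point_on_ball infX ballF covF irrF sfF FB.
have xx' : `|x' - x| < t.
  move: Bz Bx' xz; rewrite Bcr => /(in_closed_ball _ _ r0) zc.
  move=> /(in_closed_ball _ _ r0) x'c /in_ball; rewrite lt_min => /andP[_ zx].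
  have : `|x' - x| <= `|x' - c| + `|z - c| + `|z - x|.
    rewrite (distrC z c) -(subrKA c x' (- x)) -(subrKA z c (- x)) addrA.
    by rewrite (le_trans (ler_normD _ _))// lerD2r ler_normD.
  lra.
have nx' A : large F d A -> ~ A x'.
  move=> LA Ax'; apply: nE'B; left; exists A; last by split=> //; exists x'.
  by split=> //; exists x'; split=> //; apply/in_ball.
have [v v0 finv] := not_clusters (locfin d x' d0).
have [||w w0 wE] := avoid_finite_closed (x := x') finv.
- by move=> A [[/ballF[c' [r' [r'0 ->]]] _] _]; exact: closed_ball_closed.
- by move=> A [/nx'].
pose m := Num.min (Num.min v w) (Num.min d (s - `|x' - x|)).
have ts : t <= s by rewrite ge_min lexx orbT.
have m0 : 0 < m by rewrite !lt_min v0 w0 d0; lra.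
have [mv mw md ms] : [/\ m <= v, m <= w, m <= d & m <= s - `|x' - x|].
  by rewrite /m !ge_min !lexx !orbT.
exists x', (m / 2); split=> //; first by rewrite divr_gt0//=; lra.
move=> y ym; split.
  have := ler_normD (y - x') (x' - x); rewrite subrKA; lra.
move=> A LA Ay; apply: (wE A y _ _ Ay); last by apply/in_ball; lra.
by split=> //; exists y; split=> //; apply/in_ball; lra.
Qed.

(** Otherwise [nested_step] could be iterated with [d = 1 / (n + 1)], and the
    common point of the resulting balls would lie in no member at all: a Baire
    category argument played on the set of accumulation points. *)
Lemma large_accumulation F : infinite_dimensional X ->
  by_closed_balls F -> covering F -> irredundant F -> star_finite F ->
  exists (d : R) x, 0 < d /\ clusters (large F d) x.
Proof.
move=> infX ballF covF irrF sfF; apply: contrapT => no.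
have locfin (e : R) y : 0 < e -> ~ clusters (large F e) y.
  by move=> e0 acc; apply: no; exists e, y.
pose P (p : nat * (X * R)) (q : X * R) :=
  clusters F p.2.1 -> 0 < p.2.2 ->
  [/\ clusters F q.1, 0 < q.2 <= p.1.+1%:R^-1 &
    forall y, `|y - q.1| <= q.2 -> `|y - p.2.1| <= p.2.2 /\
      forall B, large F p.1.+1%:R^-1 B -> ~ B y].
have /choice[f fP] : forall p, exists q, P p q.
  rewrite /P => -[n [x s]] /=.
  have [[accx s0]|] := pselect (clusters F x /\ 0 < s); last first.
    by move=> h; exists (x, s) => accx s0; case: h.
  have n0 : 0 < n.+1%:R^-1 :> R by rewrite invr_gt0.
  have [x' [s' h]] := nested_step infX ballF covF irrF sfF locfin accx s0 n0.
  by exists (x', s').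
have [x0 accx0] : exists x, clusters F x.
  have [A FA _] : (\bigcup_(A in F) A) 0 by rewrite covF.2.
  have [x _ accx] := accumulation_point_on_ball infX ballF covF irrF sfF FA.
  by exists x.
pose fix a n := if n is k.+1 then f (n, a k) else f (0%N, (x0, 1)).
have inv n : clusters F (a n).1 /\ 0 < (a n).2 <= n.+1%:R^-1.
  elim: n => [|n [IH1 /andP[IH2 _]]] /=.
    by have [] := fP (0%N, (x0, 1)) accx0 ltr01.
  by have [] := fP (n.+1, a n) IH1 IH2.
have step n y : `|y - (a n.+1).1| <= (a n.+1).2 -> `|y - (a n).1| <= (a n).2 /\
    forall B, large F n.+2%:R^-1 B -> ~ B y.
  have [accn /andP[sn _]] := inv n.
  by have [_ _] := fP (n.+1, a n) accn sn; exact.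
have [||l lP] := @nested_balls_point (fun n => (a n).1) (fun n => (a n).2).
- by move=> n; have [] := inv n.
- by move=> n y /step[].
have [B FB Bl] : (\bigcup_(A in F) A) l by rewrite covF.2.
have [c [r [r0 Bcr]]] := ballF B FB.
have [n nr] := exists_small_inv r0.
apply: (proj2 (step n l (lP n.+1)) B _ Bl); split=> //.
exists c, r; split=> //; apply: le_trans (ltW nr).
by rewrite lef_pV2 ?posrE// ler_nat.
Qed.

(** A greedy choice: the finitely many members chosen so far meet only finitely
    many members. *)
Lemma disjoint_sequence G : star_finite G -> infinite_set G ->
  exists f : nat -> set X, (forall n, G (f n)) /\
    forall m n, m != n -> f m `&` f n = set0.
Proof.
move=> sfG infG.
have /choice[g gP] : forall l : seq (set X), exists B, G B /\
    forall A, A \in l -> G A -> A `&` B = set0.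
  move=> l.
  have fin : finite_set (\bigcup_(A in [set` l] `&` G) meeting G A).
    apply: bigcup_finite; first exact/finite_setIl/finite_seq.
    by move=> A [_ GA]; exact: star_finite_meeting.
  have [B [GB nB]] := infinite_setN0 (infinite_setD infG fin).
  exists B; split=> // A Al GA; apply: contrapT => /eqP/set0P[z [Az Bz]].
  by apply: nB; exists A; [split | split=> //; exists z].
pose fix L n := if n is k.+1 then g (L k) :: L k else [::].
have mem m n : (m < n)%N -> g (L m) \in L n.
  elim: n => [//|n IH]; rewrite ltnS leq_eqVlt => /predU1P[->|/IH h] /=.
    by rewrite mem_head.
  by rewrite inE h orbT.
have lt m n : (m < n)%N -> g (L m) `&` g (L n) = set0.
  by move=> mn; apply: (gP (L n)).2; [exact: mem | exact: (gP _).1].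
exists (g \o L); split=> [n|m n /=]; first exact: (gP _).1.
by rewrite neq_ltn => /orP[/lt//|/lt]; rewrite setIC.
Qed.

(** The form in which the covering is used: a point [x] on the frontier of a ball
    of the covering, approached by infinitely many balls that are disjoint from
    each other and from that ball, and whose radii stay above [d]. Disjointness
    is recorded by the distances of the centres. *)
Lemma disjoint_balls_cluster F0 : infinite_dimensional X ->
  by_closed_balls F0 -> covering F0 -> star_finite F0 ->
  exists x c0 (r0 d : R), [/\ 0 < r0, 0 < d, `|x - c0| = r0 &
    forall s, 0 < s -> exists (c : nat -> X) (r : nat -> R), forall n,
      [/\ d <= r n, r n < `|c n - x| < r n + s, r0 + r n < `|c n - c0| &
        forall m, m != n -> r m + r n < `|c m - c n|]].
Proof.
move=> infX ballF' covF' sfF'.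
have [F FF' [covF irrF]] := irredundant_subcovering covF'
  (fun x => star_finite_point_finite x sfF').
have sfF := star_finite_sub FF' sfF'.
have ballF : by_closed_balls F by move=> B /FF'; exact: ballF'.
have [d [x [d0 accx]]] := large_accumulation infX ballF covF irrF sfF.
have [B0 FB0 B0x] : (\bigcup_(A in F) A) x by rewrite covF.2.
have [c0 [r0 [r00 B0E]]] := ballF B0 FB0.
have xc0 : `|x - c0| <= r0 by apply/in_closed_ball => //; rewrite -B0E.
have finB0 := star_finite_meeting sfF FB0.
exists x, c0, r0, d; split=> //.
  apply/eqP; rewrite eq_le xc0/= leNgt; apply/negP => xr0.
  have e0 : 0 < r0 - `|x - c0| by rewrite subr_gt0.
  apply: (accx _ e0); apply: sub_finite_set finB0 => B [[FB _] [z [Bz zx]]].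
  split=> //; exists z; split=> //; rewrite B0E; apply/in_closed_ball => //.
  move: zx => /in_ball; have := ler_normD (z - x) (x - c0); rewrite subrKA; lra.
move=> s s0.
pose G := meeting (large F d) (ball x s) `\` meeting F B0.
have [||f [fG fdis]] := @disjoint_sequence G.
- by apply: star_finite_sub sfF => B [[[]]].
- exact: infinite_setD (accx s s0) finB0.
have /choice[cr crP] : forall n, exists q : X * R,
    d <= q.2 /\ f n = closed_ball q.1 q.2.
  by move=> n; have [[[_ [c [r h]]] _] _] := fG n; exists (c, r).
exists (fun n => (cr n).1), (fun n => (cr n).2) => n.
have r_gt0 k : 0 < (cr k).2 by apply: lt_le_trans d0 (crP k).1.
have [[[Ffn _] [z [fz zx]]] nB0] := fG n.
split; first exact: (crP n).1.
- apply/andP; split.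
    (* [x] lies in [B0], which the chosen ball does not meet *)
    rewrite ltNge; apply/negP => h; apply: nB0; split=> //; exists x; split=> //.
    by rewrite (crP n).2; apply/in_closed_ball => //; rewrite distrC.
  move: fz zx; rewrite (crP n).2 => /(in_closed_ball _ _ (r_gt0 n)) zc /in_ball zx.
  have := ler_normD ((cr n).1 - z) (z - x); rewrite subrKA (distrC _ z); lra.
- rewrite distrC; apply: disjoint_closed_balls => //.
  apply: contrapT => /eqP/set0P[y [B0y fy]]; apply: nB0; split=> //; exists y.
  by rewrite (crP n).2 B0E.
- move=> m mn; apply: disjoint_closed_balls => //.
  by rewrite -(crP m).2 -(crP n).2 fdis.
Qed.

End Accumulation.

(** * Almost antipodal directions *)

Definition direction (R : realType) (X : normedModType R) (v : X) : X :=
  `|v|^-1 *: v.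

Section Directions.
Context {R : realType} {X : completeNormedModType R}.
Implicit Types (x y u v c : X).

Lemma norm_direction v : 0 < `|v| -> `|direction v| = 1.
Proof. by move=> v0; rewrite normrZ gtr0_norm ?invr_gt0// mulVf// gt_eqF. Qed.

Lemma direction_shortening v (d : R) : 0 < d <= `|v| ->
  `|v - d *: direction v| = `|v| - d.
Proof.
move=> /andP[d0 dv]; have v0 : 0 < `|v| by apply: lt_le_trans d0 dv.
rewrite /direction scalerA -{1}[v]scale1r -scalerBl normrZ ger0_norm.
  by rewrite mulrBl mul1r -mulrA mulVf ?mulr1 ?gt_eqF.
by rewrite subr_ge0 ler_pdivrMr// mul1r.
Qed.

(** Two vectors whose distance is nearly the sum of their norms still have nearly
    opposite parts after both are shortened to length [d], since shortening costs
    [`|v| - d] and [`|w| - d]. *)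
Lemma direction_gap v w (d : R) : 0 < d -> d <= `|v| -> d <= `|w| ->
  `|v - w| - (`|v| + `|w| - 2 * d) <= d * `|direction v - direction w|.
Proof.
move=> d0 dv dw.
have h1 : `|v - d *: direction v| = `|v| - d by rewrite direction_shortening ?d0.
have h2 : `|w - d *: direction w| = `|w| - d by rewrite direction_shortening ?d0.
have := ler_normD (v - d *: direction v - (w - d *: direction w))
  (d *: (direction v - direction w)).
have := ler_normB (v - d *: direction v) (w - d *: direction w).
have -> : v - d *: direction v - (w - d *: direction w) +
    d *: (direction v - direction w) = v - w.
  rewrite scalerBr [X in X + _](_ : _ =
    v - w - (d *: direction v - d *: direction w)) ?subrK//.
  by rewrite opprD addrACA -opprD.
rewrite normrZ gtr0_norm// h1 h2; lra.
Qed.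

Lemma directionN v : direction (- v) = - direction v.
Proof. by rewrite /direction normrN scalerN. Qed.

(** Seen from the accumulation point [x], the centres of the approaching balls lie
    in directions [u n] that are pairwise almost at distance two, because the
    balls are disjoint, contain nearly [x], and have radius at least [d]. For the
    same reason they are almost at distance two from the direction [- v] of the
    centre of the ball that carries [x]. *)
Lemma star_finite_covering_directions (F : set (set X)) : infinite_dimensional X ->
  by_closed_balls F -> covering F -> star_finite F ->
  exists2 v : X, unit_sphere v & forall e : R, 0 < e ->
    exists u : nat -> X, forall n, [/\ unit_sphere (u n), 2 - e <= `|v + u n| &
      forall m, m != n -> 2 - e <= `|u m - u n|].
Proof.
move=> infX ballF covF sfF.
have [x [c0 [r0 [d [r00 d0 xc0 acc]]]]] :=
  disjoint_balls_cluster infX ballF covF sfF.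
exists (direction (x - c0)); first by apply: norm_direction; rewrite xc0.
move=> e e0; pose rho := Num.min d r0.
have rho0 : 0 < rho by rewrite lt_min d0.
have [rd rr0] : rho <= d /\ rho <= r0 by rewrite /rho !ge_min !lexx orbT.
(* a gap within [2 * s] at length [rho] is a gap within [e] at length one *)
pose s := rho * e / 2.
have s0 : 0 < s by rewrite divr_gt0// mulr_gt0.
have sE : s * 2 = rho * e by rewrite /s divfK.
have [c [r crP]] := acc s s0; exists (fun n => direction (c n - x)) => n.
have [dr /andP[rc cr] rc0 rcc] := crP n.
split.
- by apply: norm_direction; lra.
- have := @direction_gap (c n - x) (- (x - c0)) rho rho0.
  rewrite normrN xc0 directionN !opprK [c n - x + _]subrKA => h.
  have {h} := h _ _; rewrite [_ + direction (c n - x)]addrC => h.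
  rewrite -(ler_pM2l rho0); apply: le_trans (h _ _) => //; last lra.
  rewrite mulrBr -sE; lra.
move=> m mn; have [dr' /andP[rc' cr'] _ _] := crP m.
have := @direction_gap (c m - x) (c n - x) rho rho0.
have -> : c m - x - (c n - x) = c m - c n by rewrite opprB subrKA.
move=> h; have [_ _ _ /(_ _ mn) cmn] := crP n.
rewrite -(ler_pM2l rho0); apply: le_trans (h _ _) => //; lra.
Qed.

Lemma diam_ge (A : set X) x y : A x -> A y -> (`|x - y|%:E <= diam A)%E.
Proof. by move=> Ax Ay; apply: ereal_sup_ubound; exists (x, y). Qed.

Lemma diam_le (A : set X) (b : R) :
  (forall x y, A x -> A y -> `|x - y| <= b) -> (diam A <= b%:E)%E.
Proof.
by move=> h; apply: ge_ereal_sup => _ [[x y] /= [Ax Ay] <-]; rewrite lee_fin; exact: h.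
Qed.

Lemma not_lnd2_direction v :
  (forall e : R, 0 < e -> exists u : nat -> X, forall n,
    [/\ unit_sphere (u n), 2 - e <= `|v + u n| &
      forall m, m != n -> 2 - e <= `|u m - u n|]) -> ~ lnd2_point v.
Proof.
move=> dirs [_ [d d0]]; apply/negP; rewrite -leNgt; apply/lee_subgt0Pr => e e0.
pose e' := Num.min e (d * 2).
have e'0 : 0 < e' by rewrite lt_min e0 mulr_gt0.
have [e'e e'd] : e' <= e /\ e' <= d * 2 by rewrite /e' !ge_min !lexx orbT.
have [u uP] := dirs e' e'0.
have near k : unit_sphere (u k) /\ 1 - d <= `|2^-1 *: (v + u k)|.
  have [uk vuk _] := uP k; split=> //; rewrite normrZ gtr0_norm ?invr_gt0//.
  by rewrite ler_pdivlMl//; lra.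
have [_ _ /(_ 1%N isT) u10] := uP 0%N.
apply: le_trans (diam_ge (near 1%N) (near 0%N)).
rewrite -EFinB lee_fin; lra.
Qed.

Lemma kottman_ge2 :
  (forall e : R, 0 < e -> exists u : nat -> X, forall n,
    unit_sphere (u n) /\ forall m, m != n -> 2 - e <= `|u m - u n|) ->
  (2%:E <= kottman X)%E.
Proof.
move=> seps; apply/lee_subgt0Pr => e e0.
pose e' := Num.min e 1.
have e'0 : 0 < e' by rewrite lt_min e0 ltr01.
have [e'e e'1] : e' <= e /\ e' <= 1 by rewrite /e' !ge_min !lexx orbT.
have [u uP] := seps e' e'0.
apply: (@le_trans _ _ (sep (range u))); last first.
  apply: ereal_sup_ubound; exists (range u) => //; split.
    by move=> _ [n _ <-]; exact: (uP n).1.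
  apply: inj_card_eq => m n _ _ umn; apply/eqP/negPn/negP => mn.
  by have := (uP n).2 m mn; rewrite umn subrr normr0; lra.
apply: le_ereal_inf_tmp => _ [[x y] /= [[m _ <-] [[n _ <-] umn]] <-].
rewrite -EFinB lee_fin; apply: (@le_trans _ _ (2 - e')); first lra.
by apply: (uP n).2; apply: contra_notN umn => /eqP ->.
Qed.

(** * Conditions implying LND2 *)

Lemma lnd2_of_small_set x (A : set X) (d : R) : unit_sphere x -> 0 < d ->
  (diam A < 2%:E)%E ->
  (forall y, unit_sphere y -> 2 - d <= `|x + y| -> A y) -> lnd2_point x.
Proof.
move=> xS d0 A2 sub; split=> //; exists (d / 2); first by rewrite divr_gt0.
apply: le_lt_trans A2; apply: ge_ereal_sup => _ [[y z] /= [yP zP] <-].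
have inA w : unit_sphere w /\ 1 - d / 2 <= `|2^-1 *: (x + w)| -> A w.
  move=> [wS]; rewrite normrZ gtr0_norm ?invr_gt0// => xw.
  by apply: sub => //; lra.
by apply: diam_ge; exact: inA.
Qed.

(** Norm convergence of all maximizing sequences, in uniform form. This serves
    both local uniform rotundity (with [phi y = `|x + y|]) and strong exposedness
    (with [phi] the exposing functional). *)
Lemma maximizing_near (A : set X) (phi : X -> R) (L : R) x (e : R) : 0 < e ->
  (forall y, A y -> phi y <= L) ->
  (forall u : nat -> X, (forall n, A (u n)) ->
    phi (u n) @[n --> \oo] --> L -> u n @[n --> \oo] --> x) ->
  exists2 d, 0 < d & forall y, A y -> L - d <= phi y -> `|y - x| < e.
Proof.
move=> e0 phiL cvgA; apply: contrapT => no.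
have /choice[u uP] : forall n : nat, exists y, A y /\ L - n.+1%:R^-1 <= phi y /\
    e <= `|y - x|.
  move=> n; apply: contrapT => nx; apply: no; exists n.+1%:R^-1.
    by rewrite invr_gt0.
  move=> y Ay phiy; rewrite ltNge; apply/negP => ey.
  by apply: nx; exists y.
have : u n @[n --> \oo] --> x.
  apply: cvgA => [n|]; first exact: (uP n).1.
  apply: (@squeeze_cvgr _ _ _ _ (fun n => L - n.+1%:R^-1) (fun _ => L)).
  - by apply: nearW => n; rewrite (uP n).2.1 phiL//; exact: (uP n).1.
  - rewrite -[X in _ --> X]subr0; apply: cvgB; first exact: cvg_cst.
    exact: cvg_harmonic.
  - exact: cvg_cst.
move=> /cvgrPdist_lt/(_ e e0)[N _ /(_ N (leqnn N))] /=.
by rewrite distrC ltNge (uP N).2.2.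
Qed.

Lemma diam_lt2_near x : (diam [set y | (`|y - x| < 2^-1)%R] < 2%:E)%E.
Proof.
apply: (@le_lt_trans _ _ 1%:E); last by rewrite lte_fin ltr1n.
apply: diam_le => y z /= yx zx; have := ler_distD x y z.
rewrite (distrC x z); lra.
Qed.

Lemma lur_lnd2 x : lur_point x -> lnd2_point x.
Proof.
move=> [xS lur]; have e0 : 0 < 2^-1 :> R by rewrite invr_gt0.
have [|d d0 dP] := maximizing_near (phi := fun y => `|x + y|) e0 _ lur.
  by move=> y yS; rewrite (le_trans (ler_normD _ _))// xS yS.
apply: (lnd2_of_small_set (A := [set y | `|y - x| < 2^-1]) xS d0 _ dP).
exact: diam_lt2_near.
Qed.

Lemma dual_sphere_le (f : {linear X -> R^o}) x : dual_sphere f -> `|f x| <= `|x|.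
Proof.
move=> [_ f1]; have [->|x0] := eqVneq x 0; first by rewrite linear0 !normr0.
have nx : 0 < `|x| by rewrite normr_gt0.
have : (`|f (direction x)|%:E <= 1%:E)%E.
  rewrite -f1; apply: ereal_sup_ubound; exists (direction x) => //.
  by apply/in_closed_ball => //; rewrite subr0 norm_direction.
rewrite lee_fin functionalZ normrM gtr0_norm ?invr_gt0//.
by rewrite ler_pdivrMl// mulr1.
Qed.

Lemma dual_sphere_almost_norming (f : {linear X -> R^o}) (e : R) : 0 < e ->
  dual_sphere f -> exists2 u, `|u| <= 1 & 1 - e < f u.
Proof.
move=> e0 [_ f1].
have /ereal_sup_gt[_ [y /in_closed_ball y1 <-]] : ((1 - e)%:E < dual_norm f)%E.
  by rewrite f1 lte_fin; lra.
rewrite lte_fin => ey; have {y1} := y1 ltr01; rewrite subr0 => y1.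
have [fy|fy] := leP 0 (f y); first by exists y => //; rewrite ger0_norm in ey.
by exists (- y); rewrite ?normrN// linearN; rewrite ltr0_norm in ey.
Qed.

(** Smoothness makes [`|x + h| + `|x - h| - 2] small compared with [`|h|]. If
    [`|x + y|] is almost two, then [`|x + r *: y|] is almost [1 + r] for [r <= 1],
    hence [`|x - r *: y|] is almost [1 - r]; as it is at least [1 - r * f y], the
    value [f y] is almost one. *)
Lemma frechet_smooth_slice x (f : {linear X -> R^o}) (e : R) : 0 < e ->
  frechet_smooth_point x -> dual_sphere f -> f x = 1 ->
  exists2 d, 0 < d & forall y, unit_sphere y -> 2 - d <= `|x + y| -> 1 - e < f y.
Proof.
move=> e0 [xS dx] fS fx.
have e40 : 0 < e / 4 by rewrite divr_gt0.
have /eqaddoP/(_ _ e40)/nbhs_ballP[t /= t0 tP] := diff_locally dx.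
pose D := 'd (fun y : X => `|y| : R^o) x.
have D_approx h : `|h| < t -> `| (`|x + h| - 1 - D h) | <= e / 4 * `|h|.
  move=> ht; have : ball 0 t h by apply/in_ball; rewrite subr0.
  move=> hb.
  have : `| (`|h + x| - (`|x| + D h)) | <= e / 4 * `|h| := tP h hb.
  by rewrite opprD addrA xS [h + x]addrC.
(* [r <= 1] lets [x + y] be compared with [x + r *: y] by the triangle inequality *)
pose r := Num.min (t / 2) 1.
have r0 : 0 < r by rewrite lt_min ltr01 divr_gt0.
have [rt r1] : r <= t / 2 /\ r <= 1 by rewrite /r !ge_min !lexx orbT.
exists (r * (e / 4)); first by rewrite !mulr_gt0.
move=> y yS xy.
have nry : `|r *: y| = r by rewrite normrZ yS mulr1 gtr0_norm.
have plus : `|x + r *: y| - 1 - D (r *: y) <= e / 4 * r.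
  by rewrite -[X in _ <= _ * X]nry (le_trans (ler_norm _))// D_approx// nry; lra.
have minus : `|x - r *: y| - 1 + D (r *: y) <= e / 4 * r.
  have := @D_approx (- (r *: y)); rewrite normrN nry linearN opprK => h.
  by rewrite (le_trans (ler_norm _))// h//; lra.
have below : 1 - r * f y <= `|x - r *: y|.
  have := dual_sphere_le (x - r *: y) fS.
  rewrite linearB functionalZ fx => /(le_trans (ler_norm _)); exact.
have above : 1 + r - r * (e / 4) <= `|x + r *: y|.
  have : `|x + y| <= `|x + r *: y| + `|(1 - r) *: y|.
    by rewrite (le_trans _ (ler_normD _ _))// scalerBl scale1r addrAC -addrA subrK.
  rewrite normrZ yS mulr1 ger0_norm; lra.
have : r * (1 - e) < r * f y by rewrite mulrBr; nra.
by rewrite ltr_pM2l.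
Qed.

Lemma strongly_exposed_lnd2 x :
  frechet_smooth_point x -> strongly_exposed_point x -> lnd2_point x.
Proof.
move=> frx [xS [f fS [fx exposed]]].
have e0 : 0 < 2^-1 :> R by rewrite invr_gt0.
have [|d d0 dP] := maximizing_near (phi := f) e0 _ exposed.
  move=> y /in_closed_ball -/(_ ltr01); rewrite subr0 => y1.
  by rewrite (le_trans (ler_norm _))// (le_trans (dual_sphere_le _ fS)).
have [t t0 tP] := frechet_smooth_slice d0 frx fS fx.
apply: (lnd2_of_small_set xS t0 (diam_lt2_near x)) => y yS /(tP _ yS) /ltW.
by apply: dP; apply/in_closed_ball => //; rewrite subr0 yS.
Qed.

Lemma support_slice_lnd2 x :
  frechet_smooth_point x -> support_slice_diam_lt2 x -> lnd2_point x.
Proof.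
move=> frx [f [fS [_ fsup] _ [d d0 dP]]]; have xS := frx.1.
have fx : f x = 1.
  apply/eqP; rewrite eq_le; apply/andP; split.
    by rewrite (le_trans (ler_norm _))// -xS dual_sphere_le.
  apply/ler_addgt0Pr => e e0.
  have [u u1 fu] := dual_sphere_almost_norming e0 fS.
  have : f u <= f x by apply: fsup; apply/in_closed_ball => //; rewrite subr0.
  lra.
have [t t0 tP] := frechet_smooth_slice d0 frx fS fx.
apply: (lnd2_of_small_set xS t0 dP) => y yS xy; split; last exact: tP.
by apply/in_closed_ball => //; rewrite subr0 yS.
Qed.

End Directions.

(** * Cone smooth points *)

Section ConeSmooth.
Context {R : realType} {X : completeNormedModType R}.
Implicit Types (x y u v c w : X).

Lemma support_functional x : unit_sphere x ->
  exists2 f : {linear X -> R^o}, dual_sphere f & f x = 1.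
Proof.
move=> xS; have [f [fle fx]] := norm_attaining_functional x.
exists f; last by rewrite fx xS.
split.
  apply: bounded_linear_continuous; apply/linear_boundedP.
  by exists 1; split=> // r r1 y; rewrite (le_trans (fle y))// ler_peMl// ltW.
apply/eqP; rewrite eq_le; apply/andP; split.
  apply: ge_ereal_sup => _ [y /(in_closed_ball _ _ ltr01) y1 <-].
  by rewrite lee_fin (le_trans (fle y))//; rewrite subr0 in y1.
apply: ereal_sup_ubound; exists x; last by rewrite fx xS normr1.
by apply/in_closed_ball => //; rewrite subr0 xS.
Qed.

(** Let [h] be the direction of [c]. The difference quotients of the norm at [x]
    along [h] are at least [f h >= 1 / 7] for positive steps, and by uniform
    smoothness those for small negative steps differ from them by less than
    [1 / 7]; so the norm does not increase from [x] to [x - c]. *)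
Lemma uniformly_smooth_cone_smooth : uniformly_frechet_smooth X ->
  exists2 e : R, 0 < e & forall x : X, unit_sphere x -> cone_smooth_point e x.
Proof.
move=> [d dP].
have [t t0 tP] : exists2 t : R, 0 < t & forall s x h, 0 < `|s| < t ->
    unit_sphere x -> unit_sphere h ->
    `| (d (x, h) - (`|x + s *: h| - `|x|) / s) | < 14^-1.
  have e0 : 0 < 14^-1 :> R by rewrite invr_gt0.
  have /dP : nbhs (d : {uniform` (@unit_sphere R X) `*` unit_sphere -> R})
      [set g | forall p, (unit_sphere `*` unit_sphere) p -> `|d p - g p| < 14^-1].
    apply/uniform_nbhs; exists [set q | `|q.1 - q.2| < 14^-1]; split=> //.
    exact: entourage_ball (PosNum e0).
  move=> /nbhs_ballP[t /= t0 tP]; exists t => // s x h /andP[s0 st] xS hS.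
  apply: (tP s _ _ (x, h)) => //; last by rewrite -normr_gt0.
  by apply/in_ball; rewrite subr0.
exists (t / 2); first by rewrite divr_gt0.
move=> x xS; split=> //; have [f fS fx] := support_functional xS.
exists f => // z [[c cC <-] [b /(in_closed_ball _ _ ltr01) b1 /= xb]].
rewrite subr0 in b1.
apply/in_closed_ball => //; rewrite subr0.
have [->|c0] := eqVneq c 0; first by rewrite subr0 xS.
have nc0 : 0 < `|c| by rewrite normr_gt0.
have nct : `|c| < t.
  have : `|c| <= t / 2.
    have -> : c = - ((t / 2) *: b).
      by apply/eqP; rewrite -eqr_oppLR -(inj_eq (addrI x)) xb.
    by rewrite normrN normrZ gtr0_norm ?divr_gt0// ler_piMr// ltW// divr_gt0.
  lra.
have hS : unit_sphere (direction c) by exact: norm_direction.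
have cE : c = `|c| *: direction c.
  by rewrite /direction scalerA mulfV ?gt_eqF// scale1r.
have fd : 7^-1 <= f (direction c).
  by move: cC; rewrite /cone/= /direction functionalZ ler_pdivlMl// mulrC.
have q1 : f (direction c) <= (`|x + `|c| *: direction c| - `|x|) / `|c|.
  rewrite ler_pdivlMr// xS -cE lerBrDr.
  have := dual_sphere_le (x + c) fS; rewrite linearD fx {1}cE functionalZ => h.
  have := le_trans (ler_norm _) h; lra.
have := tP `|c| x (direction c) _ xS hS.
rewrite normr_id nc0 nct ltr_distlC => /(_ isT)/andP[_ h1].
have := tP (- `|c|) x (direction c) _ xS hS.
rewrite normrN normr_id nc0 nct ltr_distlC => /(_ isT)/andP[h2 _].
rewrite scaleNr -cE xS invrN mulrN -mulNr opprB in h2.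
have : 0 <= (1 - `|x - c|) / `|c| by lra.
by rewrite pmulr_lge0 ?invr_gt0// subr_ge0.
Qed.

(** Density provides cone smooth points of the given ball arbitrarily close to
    the boundary point [c + r *: u]. *)
Lemma cone_smooth_ball (e : R) (c : X) (r s : R) u : 0 < e -> 0 < r -> 0 < s ->
  unit_sphere `<=` closure [set x : X | cone_smooth_point e x] ->
  unit_sphere u ->
  exists q (f : {linear X -> R^o}), [/\ dual_sphere f, `|q - (c + r *: u)| < s &
    forall w, `|w| <= e * r -> 7^-1 * `|w| <= f w -> `|q - w - c| <= r].
Proof.
move=> e0 r0 s0 dense uS; have sr0 : 0 < s / r by rewrite divr_gt0.
have [y [[yS [f fS fy]] yu]] := dense u uS _ (nbhsx_ballx u _ sr0).
exists (c + r *: y), f; split=> //.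
  move: yu => /in_ball; rewrite [c + r *: y]addrC addrKA -scalerBr normrZ gtr0_norm//.
  by rewrite ltr_pdivlMr// mulrC.
move=> w we fw; have : unit_ball (y - r^-1 *: w).
  apply: fy; split.
    exists (r^-1 *: w) => //.
    by rewrite /cone/= functionalZ normrZ gtr0_norm ?invr_gt0// mulrCA ler_pM2l ?invr_gt0.
  exists (- ((e * r)^-1 *: w)).
    apply/in_closed_ball => //; rewrite subr0 normrN normrZ gtr0_norm ?invr_gt0 ?mulr_gt0//.
    by rewrite ler_pdivrMl ?mulr_gt0// mulr1.
  by rewrite scalerN scalerA invfM mulrA mulfV ?gt_eqF// mul1r.
move=> /(in_closed_ball _ _ ltr01); rewrite subr0 => h.
have -> : c + r *: y - w - c = r *: (y - r^-1 *: w).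
  by rewrite scalerBr scalerA mulfV ?gt_eqF// scale1r addrAC [c + _]addrC addrK.
by rewrite normrZ gtr0_norm// ler_piMr// ltW.
Qed.

(** Let [u i] almost norm [f i]. If no [w] does for both [f i] and [f j], then
    [(u i + u j) / 2] does not, so that [f j] is quite negative at [u i]
    or [f i] at [u j] ([opp i j] or [opp j i]). But one [u i] cannot be opposed by
    two functionals, for then [- u i] does for both. Such a tournament with
    all outdegrees at most one has fewer than four vertices. *)
Lemma functionals_common_direction (f : nat -> {linear X -> R^o}) :
  (forall i, dual_sphere (f i)) ->
  exists i j w, [/\ i != j, `|w| <= 1, 4^-1 <= f i w & 4^-1 <= f j w].
Proof.
move=> fS; apply: contrapT => no.
have q0 : 0 < 4^-1 :> R by rewrite invr_gt0.
have /choice[u uP] : forall i, exists u, `|u| <= 1 /\ 3 / 4 < f i u.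
  move=> i; have [u u1 fu] := dual_sphere_almost_norming q0 (fS i).
  by exists u; split=> //; lra.
pose opp i j := f j (u i) < - 4^-1.
have opp_total i j : i != j -> opp i j || opp j i.
  move=> ij; apply/negPn/negP; rewrite negb_or -!leNgt => /andP[ji ij'].
  apply: no; exists i, j, (2^-1 *: (u i + u j)).
  have := (uP i).2; have := (uP j).2; have := ler_normD (u i) (u j).
  have := (uP i).1; have := (uP j).1.
  rewrite !functionalZ normrZ gtr0_norm ?invr_gt0// !linearD => *.
  by split=> //; lra.
have opp_one i j k : j != k -> opp i j -> opp i k -> False.
  rewrite /opp => jk oj ok; apply: no; exists j, k, (- u i).
  rewrite normrN !linearN; split=> //; [exact: (uP i).1 | lra | lra].
have opp0 j k : j != 0%N -> k != 0%N -> j != k -> opp 0%N j || opp 0%N k.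
  move=> j0 k0 jk; rewrite -[_ || _]negbK negb_or; apply/negP => /andP[nj nk].
  have j0' : opp j 0%N by have := opp_total _ _ j0; rewrite (negbTE nj) orbF.
  have k0' : opp k 0%N by have := opp_total _ _ k0; rewrite (negbTE nk) orbF.
  have /orP[ojk|okj] := opp_total _ _ jk.
    by apply: (opp_one j 0%N k); rewrite // eq_sym.
  by apply: (opp_one k 0%N j); rewrite // eq_sym.
have not2 j k : j != k -> opp 0%N j && opp 0%N k = false.
  by move=> jk; apply/negP => /andP[]; exact: opp_one.
have := opp0 1%N 2%N isT isT isT; have := opp0 1%N 3%N isT isT isT.
have := opp0 2%N 3%N isT isT isT; have := not2 1%N 2%N isT.
have := not2 1%N 3%N isT; have := not2 2%N 3%N isT.
by case: (opp 0%N 1%N); case: (opp 0%N 2%N); case: (opp 0%N 3%N).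
Qed.

(** Each ball approaching [x] contains a truncated cone whose vertex is near [x]
    and whose size is at least [e * d]. Two of these cones have a common
    direction [w] well inside them, and moving from one vertex by [- t *: w],
    with [t] large compared with the distance of the vertices, reaches both
    cones, although the balls are disjoint. *)
Lemma cone_smooth_no_covering (F : set (set X)) (e : R) :
  infinite_dimensional X -> 0 < e ->
  unit_sphere `<=` closure [set x : X | cone_smooth_point e x] ->
  by_closed_balls F -> covering F -> star_finite F -> False.
Proof.
move=> infX e0 dense ballF covF sfF.
have [x [c0 [r0 [d [_ d0 _ acc]]]]] :=
  disjoint_balls_cluster infX ballF covF sfF.
(* half the truncation radius, to leave room for changing the vertex; the
   margin between [1 / 4] and [1 / 7] absorbs the distance of the vertices *)
pose t := e * d / 2; pose s := t / 64.
have t0 : 0 < t by rewrite divr_gt0// mulr_gt0.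
have s0 : 0 < s by rewrite divr_gt0.
have sE : t = s * 64 by rewrite /s divfK.
have tE : e * d = t * 2 by rewrite /t divfK.
have [c [r crP]] := acc s s0.
have r_gt0 n : 0 < r n by have [dr _ _ _] := crP n; apply: lt_le_trans d0 dr.
have /choice[qf qfP] : forall i : nat, exists qf : X * {linear X -> R^o},
    [/\ dual_sphere qf.2, `|qf.1 - x| < 2 * s & forall w, `|w| <= e * d ->
      7^-1 * `|w| <= qf.2 w -> `|qf.1 - w - c i| <= r i].
  move=> i; have [dr /andP[rc cr] _ _] := crP i.
  have uS : unit_sphere (direction (x - c i)).
    by apply: norm_direction; rewrite distrC (lt_trans (r_gt0 i)).
  have [q [f [fS qs fq]]] := cone_smooth_ball (c i) e0 (r_gt0 i) s0 dense uS.
  exists (q, f); split=> //=; last first.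
    by move=> w we; apply: fq; rewrite (le_trans we)// ler_pM2l.
  have := direction_shortening (v := x - c i) (d := r i).
  rewrite r_gt0 (distrC x) (ltW rc) => /(_ isT) sh.
  have := ler_normB (q - (c i + r i *: direction (x - c i)))
    (x - c i - r i *: direction (x - c i)).
  have -> : q - (c i + r i *: direction (x - c i)) -
      (x - c i - r i *: direction (x - c i)) = q - x.
    by rewrite -[x - c i - _]addrA -opprD opprB addrA subrK.
  rewrite sh; lra.
have [i [j [w [ij w1 fi fj]]]] := functionals_common_direction
  (f := fun i => (qf i).2) (fun i => let: And3 h _ _ := qfP i in h).
have [_ qi hi] := qfP i; have [fjS qj hj] := qfP j.
pose p := (qf i).1 - t *: w.
have ntw : `|t *: w| <= t by rewrite normrZ gtr0_norm// ler_piMr// ltW.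
have pi : `|p - c i| <= r i.
  apply: hi; first lra.
  have : t * 4^-1 <= (qf i).2 (t *: w) by rewrite functionalZ ler_pM2l.
  lra.
have pj : `|p - c j| <= r j.
  pose g := (qf j).1 - (qf i).1.
  have ng : `|g| <= 4 * s.
    have := ler_distD x (qf j).1 (qf i).1; rewrite (distrC x) -/g; lra.
  have -> : p = (qf j).1 - (t *: w + g) by rewrite /p /g opprD addrCA opprB subrKC addrC.
  have nwg : `|t *: w + g| <= t + 4 * s.
    by rewrite (le_trans (ler_normD _ _))// lerD.
  apply: hj; first lra.
  have : t * 4^-1 <= (qf j).2 (t *: w) by rewrite functionalZ ler_pM2l.
  have := dual_sphere_le g fjS; rewrite ler_norml => /andP[fg _].
  have -> : (qf j).2 (t *: w + g) = (qf j).2 (t *: w) + (qf j).2 g.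
    by rewrite linearD.
  lra.
have [_ _ _ /(_ i ij)] := crP j.
have := ler_distD p (c i) (c j); rewrite (distrC (c i) p); lra.
Qed.

End ConeSmooth.

Theorem corollary3p11 (R : realType) (X : completeNormedModType R)
    (X_infinite_dim : infinite_dimensional X)
    (X_cond :
      [\/ uniformly_frechet_smooth X,
          exists2 eps : R, 0 < eps &
            unit_sphere `<=` closure [set x : X | cone_smooth_point eps x],
          (kottman X < 2%:E)%E |
          forall x : X, unit_sphere x ->
            [\/ lur_point x,
                lnd2_point x,
                frechet_smooth_point x /\ strongly_exposed_point x |
                frechet_smooth_point x /\ support_slice_diam_lt2 x]]) :
  ~ exists F : set (set X),
      [/\ covering F, by_closed_balls F & star_finite F].
Proof.
move=> [F [covF ballF sfF]].
have [v vS dirs] := star_finite_covering_directions X_infinite_dim ballF covF sfF.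
case: X_cond => [smooth|[e e0 dense]|kot|pts].
- have [e e0 cs] := uniformly_smooth_cone_smooth smooth.
  apply: (cone_smooth_no_covering X_infinite_dim e0 _ ballF covF sfF).
  by move=> x /cs csx; exact: subset_closure.
- exact: (cone_smooth_no_covering X_infinite_dim e0 dense ballF covF sfF).
- move: kot; apply/negP; rewrite -leNgt; apply: kottman_ge2 => e /dirs[u uP].
  by exists u => n; have [uS _ usep] := uP n.
- apply: (not_lnd2_direction dirs); have [|//|[]|[]] := pts v vS.
  + exact: lur_lnd2.
  + exact: strongly_exposed_lnd2.
  + exact: support_slice_lnd2.
Qed.
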